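(* Let $f(x)=a_0x^n+a_1x^{n-1}+\cdots+a_n$ be a polynomial of degree $n$ with $a_0,a_1,\ldots,a_n\in\mathbb{R}$ and $a_0>0$, and let $M$ be an integer with $1\le M\le n$. If the infinite generalized Hurwitz matrix $H_M(f)$ is totally nonnegative, then $f$ has no zeros in the sector $$\left\{z\in\mathbb{C}\setminus\{0\}: |\arg(z)|<\frac{\pi}{M}\right\}.$$
   Context: $\arg$ denotes the principal argument of a nonzero complex number, with values in $(-\pi,\pi]$. For $f(x)=a_0x^n+\cdots+a_n$ and a positive integer $M$, the generalized Hurwitz matrix is the infinite matrix $H_M(f)=(a_{Mj-i})_{i,j=1}^{\infty}$ (row index $i$, column index $j$), where $a_k:=0$ for integers $k<0$ and $k>n$. A (finite or infinite) matrix is totally nonnegative if all of its finite minors are nonnegative. *)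

(* Defs.v *)
From HB Require Import structures.
From mathcomp Require Import all_boot all_order all_algebra.
From mathcomp Require Import all_classical all_reals all_analysis.
From mathcomp Require Import complex.

Set Implicit Arguments.
Unset Strict Implicit.
Unset Printing Implicit Defensive.

Import Order.TTheory GRing.Theory Num.Theory.

Local Open Scope ring_scope.

(* For f = a_0 x^n + a_1 x^(n-1) + ... + a_n of degree n = (size f).-1, this is
   the coefficient a_k, extended by 0 to the integers k < 0 and k > n.  The
   library coefficients are in ascending order: a_k = f`_(n - k). *)
Definition desc_coef (R : nzRingType) (f : {poly R}) (k : int) : R :=
  match k with
  | Posz m => if (m <= (size f).-1)%N then f`_((size f).-1 - m) else 0
  | Negz _ => 0
  end.

(* H_M(f) = (a_(Mj - i)) for i, j >= 1: the entry in row i and column j is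
   hurwitz_mx M f i.-1 j.-1, since rows and columns are numbered from 0 here. *)
Definition hurwitz_mx (R : nzRingType) (M : nat) (f : {poly R})
    (i j : nat) : R :=
  desc_coef f ((M * j.+1)%N%:Z - i.+1%:Z).

Definition totally_nonneg (R : numDomainType) (A : nat -> nat -> R) : Prop :=
  forall (k : nat) (r c : 'I_k -> nat),
    {homo r : i j / (i < j)%N} -> {homo c : i j / (i < j)%N} ->
    0 <= \det (\matrix_(i < k, j < k) A (r i) (c j)).

(* Principal argument, with values in ]-pi, pi]; see carg_itv and carg_polar.
   Only meaningful for z != 0. *)
Definition carg (R : realType) (z : R[i]) : R :=
  let t := acos (complex.Re z / Normc.normc z) in
  if 0 <= complex.Im z then t else - t.

Section carg_theory.
Variable R : realType.
Implicit Type z : R[i].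

Let normc_sq z : Normc.normc z ^+ 2 = complex.Re z ^+ 2 + complex.Im z ^+ 2.
Proof. by case: z => a b /=; rewrite sqr_sqrtr// addr_ge0 ?sqr_ge0. Qed.

Let normc_gt0 z : z != 0 -> 0 < Normc.normc z.
Proof.
move=> z0; rewrite lt_neqAle; apply/andP; split.
  by rewrite eq_sym; apply: contra z0 => /eqP/Normc.eq0_normc ->.
by case: z {z0} => a b /=; exact: sqrtr_ge0.
Qed.

Let ratio_itv z : z != 0 -> -1 <= complex.Re z / Normc.normc z <= 1.
Proof.
move=> z0; rewrite -ler_norml normrM normfV (gtr0_norm (normc_gt0 z0)).
rewrite ler_pdivrMr ?normc_gt0// mul1r.
rewrite -ler_sqr ?nnegrE ?normr_ge0 ?(ltW (normc_gt0 z0))//.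
by rewrite real_normK ?num_real// normc_sq lerDl sqr_ge0.
Qed.

Lemma carg_itv z : z != 0 -> - pi < carg z <= pi.
Proof.
move=> z0; rewrite /carg.
have p0 := pi_gt0 R; have rI := ratio_itv z0.
case: ifPn => [_|]; first by rewrite acos_lepi// andbT
  (lt_le_trans _ (acos_ge0 rI))// oppr_lt0.
rewrite -ltNge => y0; rewrite ltrN2 acos_ltpi /=.
  by rewrite (@le_trans _ _ 0) ?oppr_le0 ?acos_ge0// ltW.
case/andP: rI => rI1 ->; rewrite andbT lt_neqAle rI1 andbT.
apply/eqP => e.
have n0 := normc_gt0 z0.
have eRe : complex.Re z = - Normc.normc z.
  by rewrite -[LHS](divfK (lt0r_neq0 n0)) -e mulN1r.
have := normc_sq z; rewrite eRe sqrrN => /eqP.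
by rewrite -[eqbLHS]addr0 (inj_eq (addrI _)) eq_sym sqrf_eq0 lt_eqF.
Qed.

Lemma carg_polar z : z != 0 ->
  complex.Re z = Normc.normc z * cos (carg z) /\
  complex.Im z = Normc.normc z * sin (carg z).
Proof.
move=> z0; have rI := ratio_itv z0; have n0 := normc_gt0 z0.
have nn : Normc.normc z != 0 by rewrite gt_eqF.
have s : Normc.normc z * Num.sqrt (1 - (complex.Re z / Normc.normc z) ^+ 2) =
         `|complex.Im z|.
  rewrite -{1}(gtr0_norm n0) -sqrtr_sqr -sqrtrM ?sqr_ge0// -sqrtr_sqr.
  congr Num.sqrt; rewrite mulrBr mulr1 -exprMn [_ * (_ / _)]mulrC divfK//.
  by rewrite {1}normc_sq addrC addKr.
have cE : cos (acos (complex.Re z / Normc.normc z)) =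
          complex.Re z / Normc.normc z by rewrite acosK// in_itv.
rewrite /carg; case: ifPn => y0.
  by rewrite cE sin_acos// s ger0_norm// mulrC divfK.
rewrite cosN sinN cE sin_acos// mulrN s ltr0_norm ?opprK; last by rewrite ltNge.
by rewrite mulrC divfK.
Qed.

End carg_theory.

(* Main.v *)
Require Import Defs.
From mathcomp Require Import all_boot all_order all_algebra.
From mathcomp Require Import all_classical all_reals all_analysis.
From mathcomp Require Import complex.
From mathcomp Require Import zify ring lra.
Import Order.TTheory GRing.Theory Num.Theory.
Local Open Scope ring_scope.
Set Implicit Arguments.
Unset Strict Implicit.
Unset Printing Implicit Defensive.

(** Write f(z) = a_0 z^n + ... + a_n and put u = 1/z, w = u^M.  Sorting the
    exponents by their residue modulo M,

      u^n f(z) = sum_(s < M) u^s P_s(w),   P_s(x) = sum_j a_(Mj+s) x^j,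

    and the rows of H_M(f) are exactly the coefficient sequences of the
    polynomials x^t P_s, ordered by increasing t and, for equal t, by decreasing
    s.  A positive z is not a zero because all a_k are nonnegative.  Otherwise,
    up to complex conjugation, u has argument t with 0 < t < pi/M.  The
    arguments of the M terms u^s P_s(w) then lie in an open half plane, and the
    term for s = 0 is nonzero; so the sum is not zero.

    For i < j < M the rows belonging to P_j and P_i form the totally nonnegative
    matrix with rows P_j, P_i, x P_j, x P_i, ...  Such a pair is governed by a
    Stieltjes continued fraction: if (p, q) is a pair and c = q(0)/p(0), then
    q - c p = x r, and (r, p) is again a pair.  Descending along this Euclidean
    algorithm ([interlace_tnn_cross]) gives, for Im w > 0,

      Im (conj(p(w)) q(w)) >= 0  and  Im (conj(q(w)) w p(w)) >= 0.

    So relative to P_0(w) the arguments of the P_s(w) are nonincreasing in s and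
    stay in [-Mt, 0].  Multiplying by u^s adds st, and any two of the resulting
    arguments differ by less than Mt < pi ([sector_sum_neq0]).

    It remains to see that P_0(w) is not zero.  The Toeplitz matrix of P_0 is a
    submatrix of H_M(f), hence totally nonnegative, and this is the theorem of
    Aissen, Edrei, Schoenberg and Whitney: P_0 has only real zeros
    ([first_rows_tnn_real_roots]).  The proof passes to the power series b(x)
    inverse to P_0(-x).  By the duality of complementary minors the minors of
    its Toeplitz matrix on consecutive columns are nonnegative
    ([inverse_last_cols_tnn]).  Those of order two make the ratios
    b_(m+1)/b_m decrease to a limit alpha, and dividing the linear recurrence of
    b by b_m shows that 1/alpha is a zero of P_0(-x).  The series
    (1 - alpha x) b(x) has nonnegative minors again ([deflate_last_cols_tnn]),
    being the limit of an elimination with a far away row; so all zeros of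
    P_0(-x) split off as real ones. *)

(** * Determinants *)

Section Determinants.
Variable R : comNzRingType.

(** The row operations may all be made at once because the transformation is
    lower unitriangular: every row is corrected by the original previous row. *)
Lemma det_sub_prev_rows k (A : nat -> 'I_k -> R) (c : nat -> R) :
    c 0%N = 0 ->
  \det (\matrix_(i < k, j < k) (A i j - c i * A i.-1 j)) =
  \det (\matrix_(i < k, j < k) A i j).
Proof.
move=> c0.
pose U : 'M[R]_k :=
  \matrix_(i, j) ((i == j)%:R - c i * (0 < i)%N%:R * (j.+1 == i :> nat)%:R).
have trU : is_trig_mx U.
  apply/is_trig_mxP => i j ij; rewrite mxE.
  have /negPf -> : i != j by rewrite -val_eqE ltn_eqF.
  have /negPf -> : j.+1 != i :> nat by rewrite gtn_eqF // ltnS ltnW.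
  by rewrite mulr0 subr0.
have detU : \det U = 1.
  rewrite det_trig // big1 // => i _; rewrite mxE eqxx.
  have /negPf -> : i.+1 != i :> nat by rewrite gtn_eqF.
  by rewrite mulr0 subr0.
rewrite -[RHS]mul1r -detU -det_mulmx; congr (\det _).
apply/matrixP => i j; rewrite !mxE.
under eq_bigr do rewrite !mxE mulrBl.
rewrite big_split /= sumrN (bigD1 i) //= eqxx mul1r big1 ?addr0; last first.
  by move=> t ti; rewrite eq_sym (negPf ti) mul0r.
congr (_ - _); case: i => -[|i] lti /=.
  by rewrite c0 mul0r big1 // => t _; rewrite !mul0r.
rewrite (bigD1 (Ordinal (ltnW lti))) //= eqxx !mulr1 big1 ?addr0 // => t ti.
by rewrite eqSS -val_eqE /= in ti *; rewrite (negPf ti) mulr0 mul0r.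
Qed.

Lemma det_first_col k (A : 'M[R]_k.+1) :
    (forall i, A (lift ord0 i) ord0 = 0) ->
  \det A =
  A ord0 ord0 * \det (\matrix_(i < k, j < k) A (lift ord0 i) (lift ord0 j)).
Proof.
move=> A0; rewrite (expand_det_col _ ord0) big_ord_recl big1 ?addr0; last first.
  by move=> i _; rewrite A0 mul0r.
rewrite /cofactor /= expr0 mul1r; congr (_ * \det _).
by apply/matrixP => i j; rewrite !mxE.
Qed.

Lemma det_mx22 (A : 'M[R]_2) :
  \det A = A ord0 ord0 * A ord_max ord_max - A ord0 ord_max * A ord_max ord0.
Proof.
rewrite (expand_det_row _ ord0) big_ord_recl big_ord1 /cofactor !det_mx11 !mxE.
rewrite /= expr0 mul1r expr1 mulN1r mulrN.
by congr (_ * A _ _ - A _ _ * A _ _); apply/val_inj.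
Qed.

End Determinants.

(** * Evaluation of real polynomials at complex points *)

Section Evaluation.
Variable R : rcfType.
Implicit Types (p q r : {poly R}) (w x y z : R[i]).

Definition ceval p w : R[i] := (map_poly (real_complex R) p).[w].

(** This is Im (conj(x) y): it is positive when y lies counterclockwise from x
    within half a turn. *)
Definition cross x y : R :=
  complex.Re x * complex.Im y - complex.Im x * complex.Re y.

Lemma cevalD p q w : ceval (p + q) w = ceval p w + ceval q w.
Proof. by rewrite /ceval rmorphD hornerD. Qed.

Lemma cevalM p q w : ceval (p * q) w = ceval p w * ceval q w.
Proof. by rewrite /ceval rmorphM hornerM. Qed.

Lemma cevalX w : ceval 'X w = w.
Proof. by rewrite /ceval map_polyX hornerX. Qed.

Lemma cevalC c w : ceval c%:P w = (c%:C)%C.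
Proof. by rewrite /ceval map_polyC hornerC. Qed.

Lemma ceval0 w : ceval 0 w = 0.
Proof. by rewrite /ceval rmorph0 horner0. Qed.

Lemma cevalE p k w : (size p <= k)%N ->
  ceval p w = \sum_(i < k) (p`_i)%:C%C * w ^+ i.
Proof.
move=> szp; rewrite /ceval (horner_coef_wide (n := k)) ?size_map_poly //.
by apply: eq_bigr => i _; rewrite coef_map.
Qed.

Lemma cross_mul z x y : cross (z * x) (z * y) = Normc.normc z ^+ 2 * cross x y.
Proof.
case: z x y => [a b] [? ?] [? ?]; rewrite /cross /= sqr_sqrtr; first by ring.
by rewrite addr_ge0 ?sqr_ge0.
Qed.

End Evaluation.

(** * Interlaced pairs of polynomials *)

Section Pairs.
Variable R : realDomainType.
Implicit Types p q r : {poly R}.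

(** The rows p, q, X p, X q, X^2 p, ... *)
Definition interlace p q (i : nat) : {poly R} :=
  'X^(i./2) * (if odd i then q else p).

(** Only the initial rows are used, not arbitrary sets of rows.  This class of
    minors is stable under the Euclidean step: subtracting a multiple of the
    previous row from a row never leads out of a set of consecutive rows. *)
Definition interlace_tnn p q : Prop :=
  forall k (c : 'I_k -> nat), {homo c : i j / (i < j)%N} ->
  0 <= \det (\matrix_(i < k, j < k) (interlace p q i)`_(c j)).

(** Together with [interlace_sub] this is the Euclidean step q - c p = X r at the
    level of rows: up to a shift of the columns, the rows of the new pair (r, p)
    are those of (p, X r) without the first. *)
Lemma interlaceS p r i : interlace p ('X * r) i.+1 = 'X * interlace r p i.
Proof.
rewrite /interlace /= uphalf_half; case: (odd i) => /=.
  by rewrite add1n exprS mulrA.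
by rewrite add0n mulrCA.
Qed.

Lemma interlace_sub p q (c : R) i :
  interlace p (q - c *: p) i =
  interlace p q i - (if odd i then c else 0) *: interlace p q i.-1.
Proof.
rewrite /interlace; case: i => [|i] /=; first by rewrite scale0r subr0.
case: (boolP (odd i)) => oi /=; first by rewrite scale0r subr0.
by rewrite uphalf_half (negPf oi) add0n mulrBr scalerAr.
Qed.

Lemma interlace_tnn_coef p q j : interlace_tnn p q -> 0 <= p`_j.
Proof.
move=> /(_ 1%N (fun=> j)); rewrite det_mx11 mxE /interlace expr0 mul1r.
by apply=> a b; rewrite !ord1.
Qed.

Lemma interlace_tnn_mulX p q :
  interlace_tnn ('X * p) ('X * q) -> interlace_tnn p q.
Proof.
move=> pq k c hc; have := pq k (fun j => (c j).+1); rewrite (_ : matrix_of_fun _ _ =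
  \matrix_(i < k, j < k) (interlace p q i)`_(c j)); first by apply=> i j /hc.
apply/matrixP => i j; rewrite !mxE /interlace.
by case: odd; rewrite mulrCA coefXM.
Qed.

(** Prefix the columns of a minor of (r, p) by column 0, in which, after the
    elimination, only the first row p has a nonzero entry, namely p(0).  The
    extended minor is p(0) times the given one and equals a minor of (p, q). *)
Lemma interlace_tnn_step p r (c : R) : 0 < p`_0 ->
  interlace_tnn p (c *: p + 'X * r) -> interlace_tnn r p.
Proof.
move=> p0 pq k d hd; rewrite -(pmulr_rge0 _ p0).
set q := c *: p + 'X * r in pq.
pose d' (j : 'I_k.+1) := if unlift ord0 j is Some i then (d i).+1 else 0%N.
have /pq : {homo d' : i j / (i < j)%N}.
  move=> i j; rewrite /d'; case: (unliftP ord0 j) => [j' ->|->] //.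
  by case: (unliftP ord0 i) => [i' ->|->] // /hd.
rewrite -(@det_sub_prev_rows _ _ (fun i j => (interlace p q i)`_(d' j))
  (fun i => if odd i then c else 0)) //.
rewrite (_ : matrix_of_fun _ _ =
  \matrix_(i, j) (interlace p ('X * r) i)`_(d' j)); last first.
  apply/matrixP => i j; rewrite !mxE -coefZ -coefB -interlace_sub.
  by rewrite /q addrC addKr.
rewrite det_first_col => [|i]; last first.
  by rewrite mxE /d' unlift_none /= interlaceS coefXM.
rewrite !mxE /d' unlift_none [_`_0%N](_ : _ = p`_0); last first.
  by rewrite /interlace expr0 mul1r.
congr (_ <= _ * \det _).
apply/matrixP => i j; rewrite !mxE liftK.
by rewrite (_ : nat_of_ord (lift ord0 i) = i.+1) // interlaceS coefXM.
Qed.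

End Pairs.

Section Stieltjes.
Variable R : rcfType.
Implicit Types (p q r : {poly R}) (w : R[i]).

Lemma coef0_eq0_mulX (p : {poly R}) : p`_0 = 0 -> exists r, p = 'X * r.
Proof.
move=> p0; exists (drop_poly 1 p); apply/polyP => -[|j].
  by rewrite coefXM.
by rewrite coefXM coef_drop_poly addn1.
Qed.

(** The minors of order two of the rows p and q on the columns 0 and j are
    - p_j q(0). *)
Lemma interlace_tnn_lead0 p q :
  interlace_tnn p q -> p`_0 = 0 -> 0 < q`_0 -> p = 0.
Proof.
move=> pq p0 q0; apply/polyP => -[|j]; first by rewrite p0 coef0.
rewrite coef0; apply/eqP; rewrite eq_le (interlace_tnn_coef _ pq) andbT.
have := pq 2 (fun i => if i == ord0 then 0%N else j.+1); rewrite det_mx22.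
rewrite !mxE /interlace /= !expr0 !mul1r p0 mul0r sub0r oppr_ge0 pmulr_lle0 //.
apply=> a b.
by case: a => -[|[|?]] //= ?; case: b => -[|[|?]] //= ?.
Qed.

(** Induction along the Euclidean algorithm.  With q = c p + w r at w, both
    quantities for (p, q) are nonnegative combinations of those for (r, p) and
    of |p(w)|^2 Im w.  This is the closure of the upper half plane under the
    steps of a Stieltjes continued fraction, in a form that allows p(w) = 0. *)
Lemma interlace_tnn_cross p q w : 0 < complex.Im w ->
  interlace_tnn p q -> (forall j, 0 <= q`_j) ->
  0 <= cross (ceval p w) (ceval q w) /\
  0 <= cross (ceval q w) (w * ceval p w).
Proof.
move=> w0; have [n] := ubnP (size p + size q).
elim: n => // n IH in p q *; rewrite ltnS => szn pq q_ge0.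
have cross0l x : cross 0 x = 0 by rewrite /cross !mul0r subr0.
have cross0r x : cross x 0 = 0 by rewrite /cross !mulr0 subr0.
have [->|pN0] := eqVneq p 0.
  by rewrite !ceval0 mulr0 cross0l cross0r.
have [->|qN0] := eqVneq q 0.
  by rewrite !ceval0 cross0l cross0r.
have p_ge0 j : 0 <= p`_j by exact: interlace_tnn_coef pq.
have szX (r : {poly R}) : 'X * r != 0 -> size ('X * r) = (size r).+1.
  by rewrite mulf_eq0 negb_or polyX_eq0 /= mulrC => /size_mulX.
have [p0|p0] := eqVneq (p`_0) 0.
  have [q0|q0] := eqVneq (q`_0) 0; last first.
    have p_eq0 : p = 0.
      by apply: interlace_tnn_lead0 pq p0 _; rewrite lt_neqAle eq_sym q0 q_ge0.
    by rewrite p_eq0 eqxx in pN0.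
  have [p' pE] := coef0_eq0_mulX p0; have [q' qE] := coef0_eq0_mulX q0.
  rewrite pE qE in pq pN0 qN0 szn *.
  have [|j|h1 h2] := IH p' q' _ (interlace_tnn_mulX pq).
  - by move: szn; rewrite !szX // addSn => /ltnW; rewrite addnS.
  - by have := q_ge0 j.+1; rewrite qE coefXM.
  rewrite !cevalM cevalX.
  by rewrite !cross_mul; split; apply: mulr_ge0; rewrite // sqr_ge0.
have {}p0 : 0 < p`_0 by rewrite lt_neqAle eq_sym p0 p_ge0.
pose c := q`_0 / p`_0.
have c0 : 0 <= c by rewrite divr_ge0 // ltW.
have [r rE] : exists r, q - c *: p = 'X * r.
  by apply: coef0_eq0_mulX; rewrite coefB coefZ /c divfK ?subrr // gt_eqF.
have qE : q = c *: p + 'X * r by rewrite -rE addrC subrK.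
have rp : interlace_tnn r p by apply: (@interlace_tnn_step _ p r c); rewrite -?qE.
(* Beyond the degree of q the coefficients of r are those of - c p / X, so
   nonnegativity forces them to vanish even when p has the larger degree. *)
have szr : (size r < size q)%N.
  rewrite -(prednK (_ : 0 < size q)%N) ?lt0n ?size_poly_eq0 // ltnS.
  apply/leq_sizeP => j; rewrite -ltnS prednK ?lt0n ?size_poly_eq0 // => szj.
  apply/eqP; rewrite eq_le (interlace_tnn_coef _ rp) andbT.
  have := congr1 (fun t : {poly R} => t`_j.+1) rE.
  rewrite coefXM coefB coefZ /= nth_default // sub0r => <-.
  by rewrite oppr_le0 mulr_ge0.
have [|h1 h2] := IH r p _ rp p_ge0.
  by apply: leq_trans szn; rewrite addnC ltn_add2l.
rewrite qE cevalD -mul_polyC !cevalM cevalX cevalC.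
move: (ceval p w) (ceval r w) h1 h2 => x y h1 h2; split.
  rewrite (_ : cross _ _ = cross x (w * y)) //.
  by case: (w) x y {h1 h2} => [? ?] [? ?] [? ?]; rewrite /cross /=; ring.
rewrite (_ : cross _ _ =
  c * ((complex.Re x ^+ 2 + complex.Im x ^+ 2) * complex.Im w) +
  (complex.Re w ^+ 2 + complex.Im w ^+ 2) * cross y x).
  rewrite addr_ge0 // mulr_ge0 // ?addr_ge0 ?sqr_ge0 //.
  by rewrite mulr_ge0 ?addr_ge0 ?sqr_ge0 // ltW.
by case: (w) x y {h1 h2} => [? ?] [? ?] [? ?]; rewrite /cross /=; ring.
Qed.

End Stieltjes.

(** * Complementary minors of inverse Toeplitz matrices *)

(** Index sets are functions on nat with an explicit bound: deleting an index is
    then just a composition with [bump] or [unbump], without casts. *)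
Definition increasing (k : nat) (r : nat -> nat) : Prop :=
  forall i j, (i < j)%N -> (j < k)%N -> (r i < r j)%N.

Lemma increasing_spread k r i j : increasing k r ->
  (i <= j)%N -> (j < k)%N -> (r i + (j - i) <= r j)%N.
Proof.
move=> hr; elim: j => [|j IH] ij jk.
  by move: ij; rewrite leqn0 => /eqP->; rewrite subnn addn0.
move: ij; rewrite leq_eqVlt => /orP[/eqP->|]; first by rewrite subnn addn0.
rewrite ltnS => ij; rewrite subSn // addnS.
by apply: leq_ltn_trans (IH ij (ltnW jk)) _; apply: hr.
Qed.

Lemma increasing_bounded_id k r i : increasing k r ->
  (forall j, (j < k)%N -> (r j < k)%N) -> (i < k)%N -> r i = i.
Proof.
case: k => // k hr rk ik.
have h1 := increasing_spread hr (leq0n i) ik.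
have h2 := increasing_spread hr (ik : (i <= k)%N) (ltnSn k).
by have := rk k (ltnSn k); lia.
Qed.

Section Complement.
Variable R : comNzRingType.

(** Completing k columns X by the unit columns outside the rows r singles out the
    minor of X on the rows r, with the sign (-1)^(sum of s_j + j).  The induction
    expands along the first column, which belongs to the least index missing
    from r; for the least one, removal lowers every later s_j and its position
    by one and leaves the parity of their sum unchanged. *)
Lemma det_unit_cols l k r : increasing k r ->
    (forall i, (i < k)%N -> (r i < l + k)%N) ->
  exists s, [/\ increasing l s, forall j, (j < l)%N -> (s j < l + k)%N,
    forall i j, (i < k)%N -> (j < l)%N -> s j != r i &
    forall X : nat -> nat -> R,
      \det (\matrix_(i < l + k, j < l + k)
              (if (j < l)%N then (i == s j :> nat)%:R else X i (j - l)%N)) =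
      (\prod_(j < l) (-1) ^+ (s j + j)) * \det (\matrix_(i < k, j < k) X (r i) j)].
Proof.
elim: l r => [|l IH] r hr rk.
  exists id; split=> // X; rewrite big_ord0 mul1r; congr (\det _).
  by apply/matrixP => i j; rewrite !mxE /= subn0 (increasing_bounded_id hr).
have exm : exists m, (m < l.+1 + k)%N && [forall i : 'I_k, r i != m].
  pose f (i : 'I_k) : 'I_(l.+1 + k) := inord (r i).
  have /subsetPn[m _ mf] : ~~ ([set: 'I_(l.+1 + k)] \subset codom f).
    apply/negP => /subset_leq_card; rewrite cardsT card_ord.
    by move=> /leq_trans/(_ (card_size _)); rewrite size_codom card_ord; lia.
  exists m; rewrite ltn_ord; apply/forallP => i; apply: contraNneq mf => rm.
  by apply/codomP; exists i; apply/val_inj; rewrite /= inordK ?rk.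
have [m /andP[mlk /forallP rNm] m_min] := ex_minnP exm.
have rNm' i : (i < k)%N -> r i != m by move=> ik; exact: (rNm (Ordinal ik)).
pose r' i := unbump m (r i).
have rK i : (i < k)%N -> bump m (r' i) = r i.
  by move=> ik; apply: unbumpK; rewrite inE rNm'.
have hr' : increasing k r'.
  move=> i j ij jk; have ik := ltn_trans ij jk.
  by rewrite ltnNge -(leq_bump2 m) !rK // -ltnNge; exact: hr.
have r'k i : (i < k)%N -> (r' i < l + k)%N.
  move=> ik; have := rk _ ik; have := rNm' _ ik; rewrite /r' /unbump.
  by move: mlk; case: ltnP; lia.
have [s' [hs' s'k s'r' sdet]] := IH r' hr' r'k.
have ms' j : (j < l)%N -> (m <= s' j)%N.
  move=> jl; rewrite leqNgt; apply/negP => sm.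
  suff /m_min : (s' j < l.+1 + k)%N && [forall i : 'I_k, r i != s' j].
    by rewrite leqNgt sm.
  apply/andP; split; first exact: leq_trans (s'k j jl) (leqnSn _).
  apply/forallP => i; apply: contra_neq (s'r' i j (ltn_ord i) jl) => ri.
  by rewrite /r' ri /unbump ltnNge ltnW // subn0.
exists (fun j => if j is j'.+1 then bump m (s' j') else m); split.
- case=> [|i] [|j] //=; rewrite ltnS => ij jl.
    by rewrite /bump ms' // add1n ltnS ms'.
  by rewrite ltnNge leq_bump2 -ltnNge hs'.
- by case=> [|j] //= jl; rewrite /bump ms' // add1n ltnS s'k.
- move=> i [|j] ik /=; first by rewrite eq_sym rNm'.
  move=> jl; rewrite -rK // (inj_eq (can_inj (bumpK m))).
  exact: s'r'.
move=> X; have dE := sdet (fun i => X (bump m i)).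
rewrite (expand_det_col _ ord0) (bigD1 (Ordinal mlk)) //= big1 ?addr0; last first.
  by move=> i im; rewrite mxE /= -val_eqE /= in im *; rewrite (negPf im) mul0r.
rewrite mxE /= eqxx mul1r /cofactor.
rewrite big_ord_recl /= -!mulrA; congr (_ * _).
rewrite (eq_bigr (fun j : 'I_l => (-1) ^+ (s' j + j))); last first.
  move=> j _; rewrite add0n [bump 0 j]add1n /bump ms' // add1n addSn addnS !exprS.
  by rewrite !mulN1r opprK.
rewrite (_ : \det (\matrix_(i < k, j < k) X (r i) j) =
   \det (\matrix_(i < k, j < k) X (bump m (r' i)) j)); last first.
  by congr (\det _); apply/matrixP => i j; rewrite !mxE rK.
rewrite -dE; congr (\det _); apply/matrixP => i j; rewrite !mxE /=.
rewrite /bump /= !add1n ltnS subSS.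
case: ifP => // jl; rewrite -/(bump m i) -/(bump m (s' j)).
by rewrite (inj_eq (can_inj (bumpK m))).
Qed.

End Complement.

Section ToeplitzDef.
Variable R : comNzRingType.
Implicit Types b : nat -> R.

Definition toeplitz b (i j : nat) : R := if (i <= j)%N then b (j - i)%N else 0.

Lemma toeplitzDl b d i j : toeplitz b (d + i) (d + j) = toeplitz b i j.
Proof. by rewrite /toeplitz leq_add2l subnDl. Qed.

Definition series_inverse (a b : nat -> R) : Prop :=
  forall m, \sum_(i < m.+1) a i * b (m - i)%N = (m == 0)%N%:R.

Lemma toeplitz_inverse a b N i j : series_inverse a b -> (j < N)%N ->
  \sum_(m < N) toeplitz a i m * toeplitz b m j = (i == j)%:R.
Proof.
move=> ab jN; rewrite -(big_mkord predT (fun m => toeplitz a i m * toeplitz b m j)).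
rewrite (big_cat_nat (n := j.+1)) //= [X in _ + X]big_nat.
rewrite [X in _ + X]big1 ?addr0; last first.
  by move=> m /andP[jm _]; rewrite /toeplitz [(m <= j)%N]leqNgt jm mulr0.
have [ij|ji] := leqP i j; last first.
  rewrite gtn_eqF // big_nat big1 // => m /andP[_ mj]; rewrite /toeplitz.
  by rewrite leqNgt (leq_ltn_trans _ ji) ?mul0r // -ltnS.
rewrite (big_cat_nat (n := i)) //=; last exact: leqW.
rewrite big_nat big1 ?add0r; last first.
  by move=> m /andP[_ mi]; rewrite /toeplitz leqNgt mi mul0r.
rewrite -[X in \sum_(X <= _ < _) _]add0n big_addn subSn // big_mkord.
have := ab (j - i)%N; rewrite subn_eq0 (_ : (j <= i)%N = (i == j)); last first.
  by rewrite eqn_leq ij.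
move=> <-; apply: eq_bigr => m _; rewrite /toeplitz leq_addl addnK.
have mij : (m + i <= j)%N by have := ltn_ord m; rewrite ltnS; lia.
by rewrite mij addnC subnDA.
Qed.

Lemma det_scale_rows_cols n (f g : nat -> R) (A : nat -> nat -> R) :
  \det (\matrix_(i < n, j < n) (f i * g j * A i j)) =
  (\prod_(i < n) f i) * (\prod_(j < n) g j) * \det (\matrix_(i < n, j < n) A i j).
Proof.
pose D h : 'M[R]_n := diag_mx (\row_(i < n) h (i : nat)).
have detD h : \det (D h) = \prod_(i < n) h i.
  by rewrite det_diag; apply: eq_bigr => i _; rewrite mxE.
rewrite -!detD mulrAC -!det_mulmx mul_diag_mx mul_mx_diag; congr (\det _).
by apply/matrixP => i j; rewrite !mxE mulrAC.
Qed.

Lemma det_last_unit_cols l k (A : nat -> nat -> R) :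
    (forall i j, (l <= j)%N -> A i j = (i == j)%:R) ->
  \det (\matrix_(i < l + k, j < l + k) A i j) = \det (\matrix_(i < l, j < l) A i j).
Proof.
move=> hA.
rewrite (_ : matrix_of_fun _ _ = block_mx (\matrix_(i < l, j < l) A i j) 0
  (\matrix_(i < k, j < l) A (l + i)%N j) 1%:M) ?det_lblock ?det1 ?mulr1 //.
apply/matrixP => i j; rewrite !mxE.
case: (splitP i) => [i' ii|i' ii]; rewrite !mxE ii.
  case: (splitP j) => [j' jj|j' jj]; rewrite !mxE jj //.
  by rewrite hA ?leq_addr // ltn_eqF // (leq_trans (ltn_ord i')) ?leq_addr.
case: (splitP j) => [j' jj|j' jj]; rewrite !mxE jj //.
by rewrite hA ?leq_addr // eqn_add2l.
Qed.

End ToeplitzDef.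

Section SeriesInverse.
Variable F : fieldType.

(** The first m coefficients of the inverse power series of a. *)
Fixpoint inverse_prefix (a : nat -> F) (m : nat) : seq F :=
  if m is m'.+1 then
    let s := inverse_prefix a m' in
    rcons s (((m' == 0)%N%:R - \sum_(i < m') a i.+1 * s`_(m' - i.+1)) / a 0%N)
  else [::].

Lemma exists_series_inverse (a : nat -> F) : a 0%N != 0 ->
  exists b, series_inverse a b.
Proof.
move=> a0; pose s := inverse_prefix a; pose b m := (s m.+1)`_m.
have szs m : size (s m) = m by elim: m => //= m IH; rewrite size_rcons IH.
have sE m i : (i < m)%N -> (s m)`_i = b i.
  elim: m => // m IH; rewrite ltnS leq_eqVlt => /orP[/eqP->//|im].
  by rewrite /= nth_rcons szs im IH.
exists b => m; rewrite big_ord_recl subn0 {1}/b /= nth_rcons szs ltnn eqxx.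
rewrite mulrC divfK // -/(s m).
rewrite (eq_bigr (fun i : 'I_m => a i.+1 * b (m - i.+1)%N)) ?subrK // => i _.
by rewrite sE // ltn_subrL (leq_trans _ (ltn_ord i)).
Qed.

End SeriesInverse.

Section Duality.
Variable R : realDomainType.
Implicit Types a b : nat -> R.

(** Minors on consecutive columns l, ..., l+k-1 and arbitrary rows that meet the
    nonzero triangle.  For the complete symmetric functions b these are the
    Schur functions (Jacobi-Trudi).  Consecutive columns are used because
    deflation combines each column with the one before it. *)
Definition last_cols_tnn b : Prop := forall l k r, increasing k r ->
  (forall i, (i < k)%N -> (r i < l + k)%N) ->
  0 <= \det (\matrix_(i < k, j < k) toeplitz b (r i) (l + j)).

(** The minors complementary to those of [last_cols_tnn]. *)
Definition first_rows_tnn a : Prop := forall l s, increasing l s ->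
  0 <= \det (\matrix_(i < l, j < l) toeplitz a i (s j)).

(** Dual Jacobi-Trudi identity.  Let T be the Toeplitz matrix of the signed
    sequence and Q the last k columns of its inverse completed by unit columns.
    Then det Q is a signed minor of b, while T Q has unit columns at the end, so
    that det (T Q) is a minor of T.  The signs from [det_unit_cols] are those
    relating the minors of the signed sequence to the minors of a. *)
Lemma inverse_last_cols_tnn a b : 0 < a 0%N ->
  series_inverse (fun i => (-1) ^+ i * a i) b ->
  first_rows_tnn a -> last_cols_tnn b.
Proof.
move=> a0 ab atnn l k r hr rk.
pose p i := (-1) ^+ i * a i; rewrite -/p in ab.
have [s [hs slk _ sdet]] := det_unit_cols R hr rk.
have {sdet} := sdet (fun i j => toeplitz b i (l + j)).
set Q := \matrix_(i, j) _; set D := \det (\matrix_(i < k, j < k) _) => detQ.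
pose T := \matrix_(i < l + k, j < l + k) toeplitz p i j.
have detT : \det T = a 0%N ^+ (l + k).
  rewrite -det_tr det_trig; last first.
    by apply/is_trig_mxP => i j ij; rewrite !mxE /toeplitz leqNgt ij.
  rewrite (eq_bigr (fun=> a 0%N)) ?prodr_const ?card_ord // => i _.
  by rewrite !mxE /toeplitz leqnn subnn /p expr0 mul1r.
have detTQ : \det (T *m Q) =
    \det (\matrix_(i < l + k, j < l + k)
      (if (j < l)%N then toeplitz p i (s j) else (i == j :> nat)%:R)).
  congr (\det _); apply/matrixP => i j; rewrite !mxE.
  under eq_bigr do rewrite !mxE.
  case: ifP => jl.
    rewrite (bigD1 (Ordinal (slk j jl))) //= eqxx mulr1 big1 ?addr0 // => m mj.
    by rewrite -val_eqE /= in mj; rewrite (negPf mj) mulr0.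
  rewrite subnKC; last by rewrite leqNgt jl.
  exact: toeplitz_inverse.
move: detTQ; rewrite det_mulmx detT detQ.
rewrite (@det_last_unit_cols _ l k (fun i j =>
   if (j < l)%N then toeplitz p i (s j) else (i == j)%:R)); last first.
  by move=> i j lj; rewrite ltnNge lj.
rewrite (_ : \matrix_(i, j) _ = \matrix_(i < l, j < l)
  ((-1) ^+ i * (-1) ^+ (s j) * toeplitz a i (s j))); last first.
  apply/matrixP => i j; rewrite !mxE ltn_ord /toeplitz.
  case: ifP => [ij|_]; last by rewrite mulr0.
  rewrite /p; congr (_ * _); rewrite -[in RHS](subnK ij) exprD mulrCA -exprD.
  by rewrite addnn -mul2n exprM sqrrN !expr1n mulr1.
rewrite (@det_scale_rows_cols _ l (fun i => (-1) ^+ i) (fun j => (-1) ^+ s j)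
  (fun i j => toeplitz a i (s j))) -big_split /=.
rewrite [in RHS](eq_bigr (fun j : 'I_l => (-1) ^+ (s j + j) : R)); last first.
  by move=> j _; rewrite -exprD addnC.
rewrite mulrCA => /(congr1 (fun x => (\prod_(j < l) (-1) ^+ (s j + j)) * x)).
rewrite !mulrA -!big_split /= big1 ?mul1r; last first.
  by move=> j _; rewrite -exprD -signr_odd oddD addbb.
move=> dE; rewrite -(pmulr_rge0 _ (exprn_gt0 (l + k) a0)) dE; exact: atnn.
Qed.

End Duality.

(** * Splitting off the zeros of the inverse *)

Section Peeling.
Import numFieldNormedType.Exports.
Local Open Scope classical_set_scope.
Variable R : realType.
Implicit Types (b : nat -> R) (p g : {poly R}).

Lemma cvg_det k (A : nat -> 'M[R]_k) (B : 'M[R]_k) :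
  (forall i j, (fun n => A n i j) @ \oo --> B i j) ->
  (fun n => \det (A n)) @ \oo --> \det B.
Proof.
move=> AB; rewrite /determinant; apply: cvg_big => [|s _].
  exact: add_continuous.
apply: cvgM; first exact: cvg_cst.
by apply: cvg_big => [|i _]; [exact: mul_continuous|exact: AB].
Qed.

(** The coefficients of the power series (1 - alpha x) b(x). *)
Definition deflate (alpha : R) b (m : nat) : R :=
  b m - alpha * (if m is m'.+1 then b m' else 0).

Lemma toeplitz_deflate alpha b i j :
  toeplitz (deflate alpha b) i j =
  toeplitz b i.+1 j.+1 - alpha * toeplitz b i.+1 j.
Proof.
rewrite /toeplitz ltnS subSS; have [ij|ji] := leqP i j; last first.
  by rewrite ltnNge ltnW // mulr0 subr0.
rewrite /deflate; case: ltngtP ij => // [ij _|-> _]; last first.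
  by rewrite subnn.
by rewrite subnS; case: (j - i)%N (subn_gt0 i j) => //; rewrite ij.
Qed.

Lemma last_cols_tnn_coef b m : last_cols_tnn b -> 0 <= b m.
Proof.
move=> /(_ m 1%N (fun=> 0%N)); rewrite det_mx11 mxE /toeplitz /= addn0 subn0.
by apply=> [i [|j]|i] //; rewrite addn1.
Qed.

Lemma last_cols_tnn_logconcave b x y : last_cols_tnn b -> (y < x)%N ->
  b x.+1 * b y <= b x * b y.+1.
Proof.
move=> btnn yx; rewrite -subr_ge0.
have := btnn x 2%N (fun i => if i is 0%N then 0%N else (x - y)%N).
rewrite det_mx22 !mxE /toeplitz /= !addn0 !subn0 addn1 leq_subr subKn ?(ltnW yx) //.
have -> : (x - y <= x.+1)%N by lia.
have -> : (x.+1 - (x - y) = y.+1)%N by lia.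
apply=> [i j|i _]; last by case: i => [|i]; lia.
by case: i j => [|i] [|[|j]] //=; rewrite subn_gt0.
Qed.

(** Add to a minor the previous column and a row at least n+1 steps above it, and
    clear this row by subtracting from each column the suitable multiple of the
    previous one.  The multipliers are the ratios b_(m+1)/b_m for large m, so the
    cleared minor tends to the minor of the deflated sequence as n grows. *)
Lemma deflate_last_cols_tnn b alpha : (forall m, 0 < b m) ->
  (fun m => b m.+1 / b m) @ \oo --> alpha ->
  last_cols_tnn b -> last_cols_tnn (deflate alpha b).
Proof.
move=> b_gt0 cvg_ratio btnn l k r hr rk.
pose rho m := b m.+1 / b m.
pose A n : 'M[R]_k := \matrix_(i < k, j < k)
  (toeplitz b (r j).+1 (l + i).+1 -
   rho (n + (l + i))%N * toeplitz b (r j).+1 (l + i)).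
suff A_ge0 n : 0 <= \det (A n).
  apply: (cvgr_to_ge (F := \oo) (f := fun n => \det (A n)));
    last exact: nearW A_ge0.
  rewrite -det_tr; apply: cvg_det => i j.
  rewrite !mxE toeplitz_deflate.
  under eq_fun do rewrite mxE.
  apply: cvgB; first exact: cvg_cst.
  apply: cvgM; last exact: cvg_cst.
  by have := cvg_ratio; rewrite -(cvg_shiftn (l + i) rho).
pose r' i := if i is i'.+1 then (n.+1 + r i')%N else 0%N.
have := btnn (n + l)%N k.+1 r'.
pose F (j : nat) (i : 'I_k.+1) := toeplitz b (r' i) (n + l + j).
rewrite -det_tr (_ : _^T = \matrix_(i, j) F i j); last first.
  by apply/matrixP => i j; rewrite !mxE.
rewrite -(@det_sub_prev_rows _ _ F
  (fun j => if j is j'.+1 then rho (n + l + j')%N else 0)) //.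
rewrite det_first_col => [|i]; last first.
  rewrite mxE /F /= /toeplitz /= !subn0 /rho addnS divfK ?subrr //.
  by rewrite gt_eqF.
rewrite [X in _ <= X * _]mxE mul0r subr0 {1}/F /toeplitz /= subn0 pmulr_rge0 //.
rewrite -/(toeplitz b) (_ : matrix_of_fun _ _ = A n); last first.
  apply/matrixP => i j; rewrite !mxE /F /r' /= /bump /= !add1n.
  by rewrite !add0n -!addnA !addSnnS !toeplitzDl addnS.
apply=> [[|i] [|j] //= ij jk|[|i] //= ik]; first by rewrite ltn_add2l; exact: hr.
  by rewrite addnS.
by have := rk i ik; lia.
Qed.

End Peeling.

Section RealRoots.
Import numFieldNormedType.Exports.
Local Open Scope classical_set_scope.
Variable R : realType.
Implicit Types (b : nat -> R) (p g : {poly R}).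

(** A zero b_m would, by log-concavity, annihilate all later coefficients.  Then
    p would have a polynomial inverse and be constant. *)
Lemma inverse_gt0 p b : series_inverse (fun i => p`_i) b -> 0 < b 0%N ->
  (1 < size p)%N -> last_cols_tnn b -> forall m, 0 < b m.
Proof.
move=> pb b0 szp btnn.
have b_ge0 m : 0 <= b m by exact: last_cols_tnn_coef.
suff b_neq0 m : b m != 0 by move=> m; rewrite lt_neqAle eq_sym b_neq0 b_ge0.
apply/negP => bm; have exm : exists m, b m == 0 by exists m.
have {exm bm}[m' /eqP bm0 m_min] := ex_minnP exm.
case: m' => [|y] in bm0 m_min; first by rewrite bm0 ltxx in b0.
have by_gt0 : 0 < b y.
  rewrite lt_neqAle b_ge0 andbT eq_sym; apply/negP => /m_min.
  by rewrite ltnn.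
have b_tail x : (y < x)%N -> b x = 0.
  case: x => // x; rewrite ltnS leq_eqVlt => /orP[/eqP <- //|yx].
  have := last_cols_tnn_logconcave btnn yx.
  by rewrite bm0 mulr0 pmulr_lle0 // => h; apply/eqP; rewrite eq_le h b_ge0.
pose q := \poly_(i < y.+1) b i.
have pq1 : p * q = 1.
  apply/polyP => j; rewrite coefM coef1 -pb; apply: eq_bigr => i _.
  by rewrite coef_poly; case: ltnP => // /b_tail ->.
have pN0 : p != 0 by rewrite -size_poly_gt0 ltnW.
have qN0 : q != 0.
  by apply: contra_eq_neq pq1 => ->; rewrite mulr0 eq_sym oner_eq0.
have := size_mul pN0 qN0; rewrite pq1 size_poly1.
move: qN0; rewrite -size_poly_gt0; case: (size q) => // v _.
by case: (size p) szp => [|[|u]] // _; rewrite addnS.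
Qed.

Lemma ratio_cvg b : (forall m, 0 < b m) -> last_cols_tnn b ->
  exists alpha : R, (fun m => b m.+1 / b m) @ \oo --> alpha.
Proof.
move=> b_gt0 btnn; exists (limn (fun m => b m.+1 / b m)).
apply: nonincreasing_is_cvgn; last first.
  by exists 0 => _ [m _ <-]; rewrite divr_ge0 // ltW.
apply/nonincreasing_seqP => m.
rewrite ler_pdivlMr // mulrAC ler_pdivrMr //.
exact: last_cols_tnn_logconcave.
Qed.

(** The recurrence sum_i p_i b_(m-i) = 0 divided by a coefficient of b becomes in
    the limit the equation p(1/alpha) = 0; the leading coefficient of p excludes
    alpha = 0. *)
Lemma ratio_root p b (alpha : R) : series_inverse (fun i => p`_i) b ->
  (1 < size p)%N -> (forall m, 0 < b m) ->
  (fun m => b m.+1 / b m) @ \oo --> alpha ->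
  alpha != 0 /\ root p alpha^-1.
Proof.
move=> pb szp b_gt0 cvg_rho; pose rho m := b m.+1 / b m.
pose n := (size p).-1; have szE : size p = n.+1 by rewrite prednK // ltnW.
have bE m d : b (m + d)%N = b m * \prod_(t < d) rho (t + m)%N.
  elim: d => [|d IH]; first by rewrite big_ord0 addn0 mulr1.
  rewrite big_ord_recr /= mulrA -IH addnS /rho addnC mulrC divfK //.
  by rewrite gt_eqF.
have rec m : \sum_(i < n.+1) p`_i * \prod_(t < n - i) rho (t + m.+1)%N = 0.
  apply: (mulfI (lt0r_neq0 (b_gt0 m.+1))); rewrite mulr0 mulr_sumr.
  have conv0 : \sum_(i < (m + n).+2) p`_i * b ((m + n).+1 - i)%N = 0 by rewrite pb.
  rewrite -[RHS]conv0.
  rewrite -(big_mkord predT (fun i => p`_i * b ((m + n).+1 - i)%N)).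
  rewrite [RHS](big_cat_nat (n := n.+1)) ?ltnS ?leqW ?leq_addl //=.
  rewrite [X in _ = _ + X]big_nat [X in _ = _ + X]big1 ?addr0; last first.
    by move=> i /andP[ni _]; rewrite nth_default ?mul0r // szE.
  rewrite big_mkord; apply: eq_bigr => i _; rewrite mulrCA -bE; congr (_ * b _).
  by have := ltn_ord i; lia.
have lim0 : \sum_(i < n.+1) p`_i * alpha ^+ (n - i) = 0.
  have : (fun m => \sum_(i < n.+1) p`_i * \prod_(t < n - i) rho (t + m.+1)%N)
      @ \oo --> \sum_(i < n.+1) p`_i * alpha ^+ (n - i).
    apply: cvg_big => [|i _]; first exact: add_continuous.
    apply: cvgM; first exact: cvg_cst.
    rewrite -[(n - i)%N in X in _ --> X]card_ord -prodr_const.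
    apply: cvg_big => [|t _]; first exact: mul_continuous.
    have := cvg_rho; rewrite -(cvg_shiftn t.+1 rho).
    by under eq_fun do rewrite addnS -addSn addnC.
  under eq_fun do rewrite rec.
  by move=> /(cvg_lim (@norm_hausdorff _ _)) <-; rewrite lim_cst.
have alpha0 : alpha != 0.
  apply: contra_eq_neq lim0 => ->; rewrite big_ord_recr /= subnn expr0 mulr1.
  rewrite big1 ?add0r; last first.
    by move=> i _; rewrite expr0n subn_eq0 leqNgt ltn_ord mulr0.
  by rewrite -[n]/(size p).-1 -lead_coefE lead_coef_eq0 -size_poly_gt0 ltnW.
split=> //; rewrite rootE horner_coef szE.
apply/eqP/(mulfI (expf_neq0 n alpha0)); rewrite mulr0 -[RHS]lim0 mulr_sumr.
apply: eq_bigr => i _; rewrite mulrCA exprVn.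
by rewrite -exprB ?unitfE // -ltnS.
Qed.

Lemma deflate_series_inverse g b alpha :
  series_inverse (fun i => (g * (1 - alpha *: 'X))`_i) b ->
  series_inverse (fun i => g`_i) (deflate alpha b).
Proof.
move=> gb m; rewrite -gb; pose B := \poly_(i < m.+1) b i.
transitivity ((g * ((1 - alpha *: 'X) * B))`_m).
  rewrite coefM; apply: eq_bigr => i _; congr (_ * _).
  rewrite mulrBl mul1r -scalerAl coefB coefZ coefXM !coef_poly /deflate.
  rewrite ltnS leq_subr.
  case: (m - i)%N (leq_subr i m) => [|d] dm //=.
  by rewrite ltnS ltnW.
rewrite mulrA coefM; apply: eq_bigr => i _.
by rewrite coef_poly ltnS leq_subr.
Qed.

(** Each step splits the real zero 1/alpha off p and replaces b by the inverse of
    the quotient. *)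
Lemma inverse_tnn_real_roots p b w : series_inverse (fun i => p`_i) b ->
  0 < b 0%N -> last_cols_tnn b -> ceval p w = 0 -> complex.Im w = 0.
Proof.
have [n] := ubnP (size p); elim: n => // n IH in p b *.
rewrite ltnS => szn pb b0 btnn pw.
have p0b0 : p`_0 * b 0%N = 1 by have := pb 0%N; rewrite big_ord1.
have [szp|szp] := leqP (size p) 1.
  move: pw p0b0; rewrite (size1_polyC szp) cevalC coefC => -[->] /eqP.
  by rewrite mul0r eq_sym oner_eq0.
have b_gt0 := inverse_gt0 pb b0 szp btnn.
have [alpha cvg_alpha] := ratio_cvg b_gt0 btnn.
have [alpha0 /factor_theorem[q pE]] := ratio_root pb szp b_gt0 cvg_alpha.
have qN0 : q != 0.
  by apply: contraTneq szp => q0; rewrite pE q0 mul0r size_poly0.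
have szq : size p = (size q).+1.
  by rewrite pE size_mul ?polyXsubC_eq0 // size_XsubC addn2.
pose g := - alpha^-1 *: q.
have {}pE : p = g * (1 - alpha *: 'X).
  rewrite pE /g -scalerAl scalerAr; congr (_ * _).
  by rewrite scaleNr -scalerN opprB scalerBr scalerA mulVf // scale1r alg_polyC.
have szg : (size g < n)%N.
  by rewrite size_scale ?oppr_eq0 ?invr_eq0 // -ltnS -szq ltnS.
move: pw; rewrite pE cevalM => /eqP; rewrite mulf_eq0 => /orP[/eqP gw|].
  apply: (IH g (deflate alpha b)) gw => //.
  - by apply: deflate_series_inverse; rewrite -pE.
  - by rewrite /deflate mulr0 subr0.
  - exact: deflate_last_cols_tnn.
rewrite (_ : 1 - alpha *: 'X = 1%:P + (- alpha)%:P * 'X); last first.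
  by rewrite mul_polyC scaleNr polyC1.
rewrite cevalD cevalM !cevalC cevalX.
case: (w) => x y; rewrite eq_complex /= => /andP[_].
rewrite (_ : _ + _ = - (alpha * y)); last by ring.
by rewrite oppr_eq0 mulf_eq0 (negPf alpha0) => /eqP.
Qed.

(** Aissen-Edrei-Schoenberg-Whitney, in the form needed for P_0: the
    inverse b belongs to p(x) = e(-x), whose zeros are the negatives of those
    of e. *)
Lemma first_rows_tnn_real_roots (e : {poly R}) w : 0 < e`_0 ->
  first_rows_tnn (fun i => e`_i) -> ceval e w = 0 -> complex.Im w = 0.
Proof.
move=> e0 etnn ew.
pose p := \poly_(i < size e) ((-1) ^+ i * e`_i).
have pE i : p`_i = (-1) ^+ i * e`_i.
  by rewrite coef_poly; case: ltnP => // szi; rewrite nth_default ?mulr0.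
have [b pb] : exists b, series_inverse (fun i => p`_i) b.
  by apply: exists_series_inverse; rewrite pE expr0 mul1r gt_eqF.
have b0 : 0 < b 0%N.
  have := pb 0%N; rewrite big_ord1 pE expr0 mul1r subnn => eb.
  by rewrite -(pmulr_rgt0 _ e0) eb.
have btnn : last_cols_tnn b.
  apply: (inverse_last_cols_tnn e0 _ etnn) => m; rewrite -pb.
  by apply: eq_bigr => i _; rewrite pE.
have : ceval p (- w) = 0.
  rewrite -ew (@cevalE _ p (size e)) ?size_poly // (@cevalE _ e (size e)) //.
  apply: eq_bigr => i _; rewrite pE rmorphM rmorphXn rmorphN1 [(- w) ^+ i]exprNn.
  by rewrite mulrACA -exprMn mulrNN mulr1 expr1n mul1r.
move/(inverse_tnn_real_roots pb b0 btnn).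
by case: (w) => x y /= /eqP; rewrite oppr_eq0 => /eqP.
Qed.

End RealRoots.

(** * Arguments of complex numbers *)

Section Sector.
Variable R : realType.
Implicit Types (x y z u w : R[i]) (a t : R).

Definition cis t : R[i] := Complex (cos t) (sin t).

Lemma cisD a t : cis (a + t) = cis a * cis t.
Proof.
by apply/eqP; rewrite eq_complex /= cosD sinD eqxx addrC [cos a * _]mulrC
  [X in _ + X]mulrC addrC eqxx.
Qed.

Lemma cisX t k : cis t ^+ k = cis (k%:R * t).
Proof.
elim: k => [|k IH]; first by rewrite mul0r /cis cos0 sin0.
by rewrite exprS IH -cisD -natr1 mulrDl mul1r addrC.
Qed.

Lemma carg_cis z : z != 0 -> z = (Normc.normc z)%:C%C * cis (carg z).
Proof.
move=> /carg_polar[zr zi]; apply/eqP; rewrite eq_complex /= !mul0r subr0 addr0.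
by rewrite -zr -zi !eqxx.
Qed.

Lemma normc_gt0 z : z != 0 -> 0 < Normc.normc z.
Proof.
move=> z0; rewrite lt_neqAle eq_sym; apply/andP; split.
  by apply: contra_neq z0 => /Normc.eq0_normc.
by case: z {z0} => a b /=; exact: sqrtr_ge0.
Qed.

Lemma cross_cis (a b s t : R) :
  cross (a%:C%C * cis s) (b%:C%C * cis t) = a * b * sin (t - s).
Proof. by rewrite /cross sinB /=; ring. Qed.

Lemma sin_ge0_ge0 t : - pi < t -> 0 <= sin t -> 0 <= t.
Proof.
move=> pt; apply: contraTT; rewrite -!ltNge => t0.
by rewrite -oppr_gt0 -sinN sin_gt0_pi // oppr_gt0 t0 /= ltrNl.
Qed.

(** Rotate by the mean mu of the extreme arguments: then all terms have positive
    real part. *)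
Lemma half_plane_sum_neq0 (n : nat) (P : pred 'I_n) (c beta : 'I_n -> R) :
    (exists i, P i) -> (forall i, P i -> 0 < c i) ->
    (forall i j, P i -> P j -> beta i - beta j < pi) ->
  \sum_(i < n | P i) (c i)%:C%C * cis (beta i) != 0.
Proof.
move=> [i0 Pi0] c_gt0 beta_pi.
have [i1 Pi1 imin] : exists2 i1, P i1 & forall j, P j -> beta i1 <= beta j.
  by case: (arg_minP beta Pi0) => i1; exists i1.
have [i2 Pi2 imax] : exists2 i2, P i2 & forall j, P j -> beta j <= beta i2.
  by case: (arg_maxP beta Pi0) => i2; exists i2.
pose mu := (beta i1 + beta i2) / 2.
apply/negP => /eqP S0.
have : complex.Re (cis (- mu) * \sum_(i < n | P i) (c i)%:C%C * cis (beta i)) = 0.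
  by rewrite S0 mulr0.
have ReD : {morph @complex.Re R : x y / x + y} by move=> [? ?] [? ?].
rewrite mulr_sumr (big_morph _ ReD (erefl : complex.Re (0 : R[i]) = 0)).
have pos i : P i -> 0 < complex.Re (cis (- mu) * ((c i)%:C%C * cis (beta i))).
  move=> Pi; rewrite mulrCA -cisD /= mul0r subr0 mulr_gt0 ?c_gt0 //.
  have := beta_pi _ _ Pi2 Pi1; have := imin _ Pi; have := imax _ Pi.
  by move=> h1 h2 h3; apply: cos_gt0_pihalf; rewrite /mu; apply/andP; split; lra.
move/(psumr_eq0P (fun i Pi => ltW (pos i Pi)))/(_ _ Pi0) => h.
by have := pos _ Pi0; rewrite h ltxx.
Qed.

(** Pairwise bounds alone would not suffice (three vectors at mutual angles of a
    third of a turn sum to zero); what makes the arguments fit into a half plane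
    is that all of them are measured from P 0 and vary monotonically. *)
Lemma sector_sum_neq0 (M : nat) (r t : R) (P : nat -> R[i]) :
    let u := r%:C%C * cis t in
    0 < r -> 0 < t -> M%:R * t < pi -> (0 < M)%N -> P 0%N != 0 ->
    (forall i j, (i < j)%N -> (j < M)%N ->
      0 <= cross (P j) (P i) /\ 0 <= cross (P i) (u ^+ M * P j)) ->
  \sum_(j < M) u ^+ j * P j != 0.
Proof.
move=> u r0 t0 Mt M0 P0 crossP.
(* P j has modulus rho j and argument gam j relative to P 0. *)
pose gam j := if j is 0 then 0 else carg (P j / P 0%N).
pose rho j := if j is 0 then 1 else Normc.normc (P j / P 0%N).
have ratio_neq0 j : P j != 0 -> P j / P 0%N != 0.
  by move=> Pj; rewrite mulf_neq0 ?invr_eq0.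
have rho_gt0 j : P j != 0 -> 0 < rho j.
  by case: j => [|j] Pj //; apply: normc_gt0; exact: ratio_neq0.
have PE j : P j != 0 -> P j = P 0%N * ((rho j)%:C%C * cis (gam j)).
  case: j => [|j] Pj.
    rewrite /rho /gam -[LHS]mulr1; congr (_ * _).
    by rewrite /cis cos0 sin0 mulr1.
  by rewrite /rho /gam -carg_cis ?ratio_neq0 // mulrC divfK.
have gam_pi j : - pi < gam j <= pi \/ P j = 0.
  have [->|Pj] := eqVneq (P j) 0; first by right.
  left; case: j Pj => [|j] Pj; last by apply: carg_itv; exact: ratio_neq0.
  by rewrite /gam /= oppr_lt0 pi_gt0 ltW ?pi_gt0.
have nP0 : 0 < Normc.normc (P 0%N) ^+ 2 by rewrite exprn_gt0 // normc_gt0.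
have uX k : u ^+ k = (r ^+ k)%:C%C * cis (k%:R * t).
  by rewrite exprMn cisX rmorphXn.
have crossE i j : P i != 0 -> P j != 0 ->
    (0 <= cross (P i) (P j)) = (0 <= sin (gam j - gam i)).
  move=> Pi Pj; rewrite (PE i) // (PE j) // cross_mul cross_cis.
  by rewrite !pmulr_rge0 // mulr_gt0 // rho_gt0.
have crossuE i j : P i != 0 -> P j != 0 ->
    (0 <= cross (P i) (u ^+ M * P j)) = (0 <= sin (M%:R * t + gam j - gam i)).
  move=> Pi Pj; rewrite (PE i) // (PE j) // [u ^+ M * _]mulrCA cross_mul uX.
  rewrite mulrACA -rmorphM -cisD cross_cis.
  by rewrite !pmulr_rge0 // !mulr_gt0 // ?exprn_gt0 ?rho_gt0.
have Mt0 : 0 < M%:R * t by rewrite mulr_gt0 ?ltr0n.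
have gam_itv j : (j < M)%N -> P j != 0 -> - (M%:R * t) <= gam j <= 0.
  case: j => [|j] jM Pj; first by rewrite lexx oppr_le0 ltW.
  have [h1 h2] := crossP 0%N j.+1 isT jM.
  have [/andP[g1 g2]|Pj0] := gam_pi j.+1; last by rewrite Pj0 eqxx in Pj.
  move: h1 h2; rewrite crossE // crossuE // subr0 sub0r => h1 h2.
  have gNpi : gam j.+1 != pi.
    apply: contraTneq h2 => ->; rewrite sinDpi oppr_ge0 -ltNge.
    by rewrite sin_gt0_pi // Mt0.
  have gle0 : gam j.+1 <= 0.
    rewrite -oppr_ge0; apply: sin_ge0_ge0 h1.
    by rewrite ltrN2 lt_neqAle gNpi.
  rewrite gle0 andbT -subr_ge0 opprK addrC; apply: sin_ge0_ge0 h2.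
  by lra.
have gam_mono i j : (i < j)%N -> (j < M)%N -> P i != 0 -> P j != 0 ->
    gam j <= gam i.
  move=> ij jM Pi Pj; have iM := ltn_trans ij jM.
  have /andP[? ?] := gam_itv _ iM Pi; have /andP[? ?] := gam_itv _ jM Pj.
  have [h1 _] := crossP i j ij jM; rewrite crossE // in h1.
  by rewrite -subr_ge0; apply: sin_ge0_ge0 h1; lra.
pose beta j := gam j + j%:R * t.
rewrite (bigID (fun j : 'I_M => P j != 0)) /= [X in _ + X]big1 ?addr0; last first.
  by move=> j; rewrite negbK => /eqP ->; rewrite mulr0.
have -> : \sum_(j < M | P j != 0) u ^+ j * P j = P 0%N *
    \sum_(j < M | P j != 0) (r ^+ j * rho j)%:C%C * cis (beta j).
  rewrite mulr_sumr; apply: eq_bigr => j Pj.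
  by rewrite {1}PE // uX mulrCA mulrACA -rmorphM -cisD /beta [gam j + _]addrC.
rewrite mulf_neq0 //; apply: half_plane_sum_neq0.
- by exists (Ordinal M0).
- by move=> j Pj; apply: mulr_gt0; [exact: exprn_gt0|exact: rho_gt0].
move=> i j Pi Pj.
have iMt k : (k < M)%N -> k%:R * t <= M%:R * t.
  by move=> kM; rewrite ler_pM2r // ler_nat ltnW.
have /andP[? ?] := gam_itv _ (ltn_ord i) Pi.
have /andP[? ?] := gam_itv _ (ltn_ord j) Pj.
rewrite /beta; case: (ltngtP i j) => [ij|ji|->].
- have : i%:R * t <= j%:R * t by rewrite ler_pM2r // ler_nat ltnW.
  by lra.
- have := gam_mono _ _ ji (ltn_ord i) Pj Pi; have := iMt _ (ltn_ord i).
  have : 0 <= j%:R * t by apply: mulr_ge0 => //; exact: ltW.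
  by lra.
- by rewrite subrr pi_gt0.
Qed.

End Sector.

(** * Dissection of a polynomial modulo M *)

Section Dissection.
Variables (R : realType) (n M : nat) (f : {poly R}).
Hypotheses (f_deg : size f = n.+1) (f_lead : 0 < lead_coef f).
Hypothesis (M_gt0 : (0 < M)%N).
Hypothesis H_tnn : totally_nonneg (hurwitz_mx M f).

Let a (k : nat) : R := desc_coef f k%:Z.

Definition dissection (s : nat) : {poly R} :=
  \poly_(j < n.+1) desc_coef f (M * j + s)%N%:Z.

Let aE k : a k = if (k <= n)%N then f`_(n - k) else 0.
Proof. by rewrite /a /desc_coef f_deg. Qed.

Lemma coef_dissection s j : (dissection s)`_j = a (M * j + s).
Proof.
rewrite coef_poly ltnS; case: leqP => // nj; rewrite aE leqNgt.
by rewrite (leq_trans nj) // (leq_trans (leq_pmull _ M_gt0)) ?leq_addr.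
Qed.

(** Row Mt + (M - s - 1), counted from 0, has the entries a_(M(j-t)+s). *)
Lemma hurwitz_dissection s t j : (s < M)%N ->
  hurwitz_mx M f (M * t + (M - s.+1)) j = ('X^t * dissection s)`_j.
Proof.
move=> sM; rewrite coefXnM coef_dissection /hurwitz_mx.
have [jt|tj] := ltnP j t.
  have : (M * j.+1 <= M * t)%N by rewrite leq_mul2l jt orbT.
  case E: (_ - _) => [m|m] //; lia.
rewrite -[in RHS]/(desc_coef f _); congr (desc_coef f _).
have : (M * t <= M * j)%N by rewrite leq_mul2l tj orbT.
by rewrite mulnBr mulnS; lia.
Qed.

Lemma dissection_interlace_tnn s s' : (s' < s)%N -> (s < M)%N ->
  interlace_tnn (dissection s) (dissection s').
Proof.
move=> s's sM k c hc.
pose r (i : 'I_k) := (M * i./2 + (M - (if odd i then s' else s).+1))%N.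
have hr : {homo r : i j / (i < j)%N}.
  move=> i j ij; rewrite /r.
  have := odd_double_half i; have := odd_double_half j.
  have [ij2|ij2] := ltnP i./2 j./2.
    have : (M * (i./2).+1 <= M * j./2)%N by rewrite leq_mul2l ij2 orbT.
    by rewrite mulnS; case: odd; case: odd; lia.
  have -> : i./2 = j./2 by lia.
  by case: (odd i); case: (odd j) => /=; lia.
have := H_tnn hr hc; congr (_ <= \det _); apply/matrixP => i j; rewrite !mxE.
rewrite hurwitz_dissection; last by case: odd => //; exact: ltn_trans sM.
by rewrite /interlace; case: odd.
Qed.

Lemma dissection0_first_rows_tnn : first_rows_tnn (fun i => (dissection 0)`_i).
Proof.
move=> l s hs.
have hr : {homo (fun i : 'I_l => (M * i + (M - 1))%N) : i j / (i < j)%N}.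
  by move=> i j ij; rewrite ltn_add2r ltn_mul2l M_gt0.
have hc : {homo (fun j : 'I_l => s j) : i j / (i < j)%N}.
  by move=> i j ij; apply: hs.
have := H_tnn hr hc; congr (_ <= \det _); apply/matrixP => i j; rewrite !mxE.
by rewrite hurwitz_dissection // coefXnM /toeplitz; case: (leqP i (s j)).
Qed.

Lemma desc_coef_ge0 k : 0 <= a k.
Proof.
have := @H_tnn 1 (fun=> M * 0 + (M - (k %% M).+1))%N (fun=> k %/ M)%N.
rewrite det_mx11 mxE hurwitz_dissection ?ltn_mod // expr0 mul1r.
rewrite coef_dissection [(M * (k %/ M))%N]mulnC -divn_eq.
by apply=> i j; rewrite !ord1.
Qed.

Lemma dissection_sum u : u != 0 ->
  \sum_(s < M) u ^+ s * ceval (dissection s) (u ^+ M) = u ^+ n * ceval f u^-1.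
Proof.
move=> u0; transitivity (\sum_(0 <= k < n.+1 * M) (a k)%:C%C * u ^+ k).
  rewrite big_nat_mul big_mkord.
  under [RHS]eq_bigr => j _.
    rewrite -[X in \sum_(X <= _ < _) _]add0n big_addn mulSn addnK big_mkord; over.
  rewrite exchange_big /=; apply: eq_bigr => s _.
  rewrite (@cevalE _ _ n.+1) ?size_poly // mulr_sumr; apply: eq_bigr => j _.
  by rewrite coef_dissection mulrCA -exprM -exprD [(s + j * M)%N]addnC mulnC
    [(s + _)%N]addnC.
rewrite (big_cat_nat (n := n.+1)) ?leq_pmulr //= [X in _ + X]big_nat.
rewrite [X in _ + X]big1 ?addr0; last first.
  by move=> k /andP[nk _]; rewrite aE leqNgt nk mul0r.
rewrite big_mkord (reindex_inj rev_ord_inj) (@cevalE _ f n.+1) ?f_deg // mulr_sumr.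
apply: eq_bigr => k _ /=; have kn : (k <= n)%N by rewrite -ltnS.
by rewrite subSS aE leq_subr subKn // mulrCA exprVn -exprB ?unitfE.
Qed.

(** Here u = 1/z is in the open upper half plane, and so is w = u^M. *)
Lemma no_root_polar rho t : 0 < rho -> 0 < t -> M%:R * t < pi ->
  ceval f (rho%:C%C * cis (- t)) != 0.
Proof.
move=> rho0 t0 Mt.
pose u : R[i] := rho^-1%:C%C * cis t.
have uz : u * (rho%:C%C * cis (- t)) = 1.
  rewrite mulrACA -rmorphM -cisD mulVf ?gt_eqF // subrr /cis cos0 sin0 mul1r //.
have u0 : u != 0.
  by apply: contra_eq_neq uz => ->; rewrite mul0r eq_sym oner_eq0.
have -> : rho%:C%C * cis (- t) = u^-1 by apply: (mulfI u0); rewrite uz divff.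
have Imw : 0 < complex.Im (u ^+ M).
  rewrite exprMn cisX -rmorphXn /= mul0r addr0 mulr_gt0 ?exprn_gt0 ?invr_gt0 //.
  by rewrite sin_gt0_pi // Mt mulr_gt0 ?ltr0n.
apply: contraTneq (sector_sum_neq0 (r := rho^-1) (t := t) (M := M)
  (P := fun s => ceval (dissection s) (u ^+ M)) _ _ _ _ _ _) => //.
- by move=> fu; rewrite -/u dissection_sum // fu mulr0 eqxx.
- by rewrite invr_gt0.
- have e0 : 0 < (dissection 0)`_0.
    rewrite coef_dissection muln0 aE subn0 leq0n.
    by move: f_lead; rewrite lead_coefE f_deg.
  apply/eqP => /(first_rows_tnn_real_roots e0 dissection0_first_rows_tnn) Im0.
  by rewrite Im0 ltxx in Imw.
move=> i j ij jM; apply: interlace_tnn_cross => //.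
  exact: dissection_interlace_tnn.
by move=> k; rewrite coef_dissection desc_coef_ge0.
Qed.

Lemma no_root_pos rho : 0 < rho -> f.[rho] != 0.
Proof.
move=> rho0; rewrite horner_coef f_deg big_ord_recr /= gt_eqF //.
have coef_ge0 i : (i <= n)%N -> 0 <= f`_i.
  by move=> i_n; have := desc_coef_ge0 (n - i); rewrite aE leq_subr subKn.
apply: ltr_wpDl; last first.
  by rewrite mulr_gt0 ?exprn_gt0 //; move: f_lead; rewrite lead_coefE f_deg.
apply: sumr_ge0 => i _; apply: mulr_ge0; last by apply: exprn_ge0; exact: ltW.
by apply: coef_ge0; exact: ltnW.
Qed.

End Dissection.

Theorem theorem4 (R : realType) (n M : nat) (f : {poly R})
    (f_deg : size f = n.+1) (f_lead : 0 < lead_coef f)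
    (M_range : (1 <= M <= n)%N)
    (H_tnn : totally_nonneg (hurwitz_mx M f)) :
  forall z : R[i], z != 0 -> `|carg z| < pi / M%:R ->
    ~~ root (map_poly (real_complex R) f) z.
Proof.
case/andP: M_range => M_gt0 _ z z0; rewrite ltr_pdivlMr ?ltr0n // mulrC => zM.
have rho0 := normc_gt0 z0; move: (carg_cis z0) zM.
set rho := Normc.normc z in rho0 *; set t := carg z => zE tM.
have no_root := no_root_polar f_deg f_lead M_gt0 H_tnn rho0.
rewrite rootE -/(ceval f z); case: (ltrgtP t 0) => ht.
- by rewrite zE -[t]opprK no_root ?oppr_gt0 // -ltr0_norm.
- rewrite -conjc_eq0.
  have -> : ((ceval f z)^*)%C = ceval f (rho%:C%C * cis (- t)).
    rewrite /ceval -horner_map -map_poly_comp /= zE rmorphM /=.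
    congr (_.[_]).
      by apply/polyP => i; rewrite !coef_map /= oppr0.
    by rewrite /cis cosN sinN oppr0.
  by rewrite no_root // -(gtr0_norm ht).
rewrite zE ht /cis cos0 sin0 mulr1.
rewrite /ceval horner_map fmorph_eq0.
by rewrite (no_root_pos f_deg f_lead M_gt0 H_tnn rho0).
Qed.
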